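(* Let $\mathcal{P}\subset\Delta(\mathcal{S})^{\mathcal{S}\times\mathcal{A}}$ be a nonempty convex compact uncertainty set. Then $$\Big(\forall\, V\in\mathbb{R}^{\mathcal{S}\times\mathcal{A}\times\mathcal{S}},\ \bigcap_{s\in\mathcal{S}}\arg\min_{P\in\mathcal{P}}\langle P_s,V_s\rangle\neq\emptyset\Big)\iff \mathcal{P}=\prod_{s\in\mathcal{S}}\mathcal{P}_s ,$$ where $\mathcal{P}_s$ is the marginal of $\mathcal{P}$ at state $s$.
   Context: $\mathcal{S}$ (states) and $\mathcal{A}$ (actions) are finite nonempty sets; $\Delta(E)$ denotes the set of probability distributions on a finite set $E$. Elements of $\mathcal{P}\subset\Delta(\mathcal{S})^{\mathcal{S}\times\mathcal{A}}$ are written $P=(P_{sa})_{(s,a)}$ with $P_{sa}\in\Delta(\mathcal{S})\subset\mathbb{R}^{\mathcal{S}}$, and $P_s=(P_{sa})_{a\in\mathcal{A}}\in\mathbb{R}^{\mathcal{A}\times\mathcal{S}}$. For $V\in\mathbb{R}^{\mathcal{S}\times\mathcal{A}\times\mathcal{S}}$, $V_s=(V_{sas'})_{a,s'}\in\mathbb{R}^{\mathcal{A}\times\mathcal{S}}$, and $\langle A,B\rangle=\sum_{i,j}A_{ij}B_{ij}$. The marginal of $\mathcal{P}$ at $s\in\mathcal{S}$ is $\mathcal{P}_s=\{(p_a)_{a\in\mathcal{A}}\in\Delta(\mathcal{S})^{\mathcal{A}} : \exists\,P\in\mathcal{P},\ (P_{sa})_{a\in\mathcal{A}}=(p_a)_{a\in\mathcal{A}}\}$.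 (The condition $\mathcal{P}=\prod_s\mathcal{P}_s$ is called s-rectangularity.) *)

(* Defs.v *)
From mathcomp Require Import all_boot all_order all_algebra.
From mathcomp Require Import boolp classical_sets functions reals.
From mathcomp Require Import topology normedtype convex.

Set Implicit Arguments.
Unset Strict Implicit.
Unset Printing Implicit Defensive.

Import Order.TTheory GRing.Theory Num.Theory.
Import numFieldNormedType.Exports.

Local Open Scope classical_set_scope.
Local Open Scope ring_scope.

Definition simplex (R : realType) (E : finType) : set (E -> R) :=
  [set p | (forall x, 0 <= p x) /\ \sum_x p x = 1].

Definition argmin (R : realType) (T : Type) (D : set T) (f : T -> R) : set T :=
  [set x | D x /\ forall y, D y -> f x <= f y].

Definition frobenius (R : realType) (I J : finType) (M N : I -> J -> R) : R :=
  \sum_i \sum_j M i j * N i j.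

(* An element P of Delta(S)^(S x A) is curried: [P s a s'] is P_{sas'}, so the
   block P_s is the partial application [P s]. *)
Section kernels.
Variables (R : realType) (S A : finType).

(* The type S -> A -> S -> R carries no topology by default; this names the
   copy with the product topology, i.e. the usual one on R^(S x A x S). *)
Definition kernel_space : topologicalType :=
  {ptws S -> {ptws A -> {ptws S -> R}}}.

Definition kernels : set (S -> A -> S -> R) :=
  [set P | forall s a, simplex (P s a)].

Definition marginal (PP : set (S -> A -> S -> R)) (s : S) : set (A -> S -> R) :=
  [set p | (forall a, simplex (p a)) /\ exists2 P, PP P & P s = p].

End kernels.

(* Main.v *)
Require Import Defs.
From mathcomp Require Import all_boot all_order all_algebra.
From mathcomp Require Import boolp classical_sets functions reals.
From mathcomp Require Import topology normedtype convex.
From mathcomp Require Import interval_inference derive ring lra.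

(** If [PP] is the product of its marginals, each block [P s] can be optimized
    on its own: compactness gives a minimizer for each state, and the kernel
    that takes its block at [s] from the minimizer for [s] lies in [PP] and is
    a minimizer for all states at once.

    Conversely, suppose that common minimizers exist for every [V], and let [Q]
    be a kernel whose blocks all belong to the marginals of [PP]. The direction
    [V] to test is the one that separates [Q] from [PP]: take the point [P0] of
    [PP] closest to [Q] in Euclidean distance, and [V := P0 - Q]. As [PP] is
    convex, [P0] minimizes the pairing [P |-> <P, V> = \sum_s <P_s, V_s>] over
    [PP] ([sqdist_min_variational]). Now let [P] minimize every summand
    [<P_s, V_s>] over [PP]. Each block [Q s] is the block at [s] of some element
    of [PP], so [<P_s, V_s> <= <Q_s, V_s>] for each [s], although that element
    depends on [s]. Summing gives
    [<P0, V> <= <P, V> <= <Q, V>], that is [<P0 - Q, P0 - Q> <= 0], whence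
    [Q = P0] belongs to [PP]. *)

Import Order.TTheory GRing.Theory Num.Theory.
Import numFieldNormedType.Exports.

Local Open Scope classical_set_scope.
Local Open Scope ring_scope.

(** The first-order condition at an endpoint: a quadratic polynomial that
    vanishes at [0] and is nonnegative on [[0, 1]] has nonnegative slope at
    [0]. *)
Lemma ge0_of_quadratic_ge0 {R : realFieldType} (c n : R) : 0 <= n ->
  (forall t, 0 <= t -> t <= 1 -> 0 <= 2 * t * c + t ^+ 2 * n) -> 0 <= c.
Proof.
move=> n_ge0 quad_ge0; rewrite leNgt; apply/negP => c_lt0.
(* Were [c] negative, the polynomial would be negative at [- c / (n - c)]. Its
   minimizer [- c / n] would not do, as it may exceed [1] and [n] may vanish. *)
have d_gt0 : 0 < n - c by lra.
have t_le1 : - c / (n - c) <= 1 by rewrite ler_pdivrMr //; lra.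
have t_ge0 : 0 <= - c / (n - c) by apply: divr_ge0; lra.
have := quad_ge0 _ t_ge0 t_le1.
have -> : 2 * (- c / (n - c)) * c + (- c / (n - c)) ^+ 2 * n =
    (c / (n - c)) ^+ 2 * (2 * c - n) by field; lra.
have c_neq0 : c / (n - c) != 0 by rewrite mulf_neq0 ?invr_eq0; lra.
by rewrite pmulr_rge0 ?exprn_even_gt0 //; lra.
Qed.

Section Frobenius.
Context {R : realType} {I J : finType}.
Implicit Types M N V : I -> J -> R.

Lemma frobeniusBl M N V :
  frobenius (fun i j => M i j - N i j) V = frobenius M V - frobenius N V.
Proof.
rewrite /frobenius -sumrB; apply: eq_bigr => i _.
by rewrite -sumrB; apply: eq_bigr => j _; rewrite mulrBl.
Qed.

Lemma frobenius_sqrDZ (t : R) M N :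
  frobenius (fun i j => M i j + t * N i j) (fun i j => M i j + t * N i j) =
  frobenius M M + 2 * t * frobenius N M + t ^+ 2 * frobenius N N.
Proof.
rewrite /frobenius !mulr_sumr -!big_split; apply: eq_bigr => i _ /=.
rewrite !mulr_sumr -!big_split; apply: eq_bigr => j _ /=; ring.
Qed.

Lemma frobenius_ge0 M : 0 <= frobenius M M.
Proof. by apply: sumr_ge0 => i _; apply: sumr_ge0 => j _; exact: sqr_ge0. Qed.

Lemma frobenius_eq0 M : frobenius M M = 0 -> forall i j, M i j = 0.
Proof.
move=> MM0 i j.
have Mi_ge0 k : 0 <= \sum_l M k l * M k l.
  by apply: sumr_ge0 => l _; exact: sqr_ge0.
have /(_ i isT)/eqP := psumr_eq0P (fun k _ => Mi_ge0 k) MM0.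
rewrite psumr_eq0 => [/allP/(_ j)|l _]; last exact: sqr_ge0.
by rewrite mem_index_enum => /(_ isT) /=; rewrite mulf_eq0 orbb => /eqP.
Qed.

End Frobenius.

Lemma frobenius_continuous {R : realType} (T : topologicalType) (I J : finType)
    (f g : T -> I -> J -> R) :
  (forall i j, continuous (fun x => f x i j)) ->
  (forall i j, continuous (fun x => g x i j)) ->
  continuous (fun x => frobenius (f x) (g x)).
Proof.
move=> cf cg; apply: continuous_big => [|i _]; first exact: add_continuous.
apply: continuous_big => [|j _]; first exact: add_continuous.
by move=> x; apply: continuousM; [exact: cf|exact: cg].
Qed.

Lemma compact_argmin_neq0 {R : realType} {T : topologicalType} (D : set T)
    (f : T -> R) :
  D !=set0 -> compact D -> continuous f -> argmin D f !=set0.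
Proof.
move=> D_neq0 D_compact f_cont.
have [x /set_mem Dx x_min] :=
  compact_EVT_min D_neq0 D_compact (continuous_subspaceT f_cont).
by exists x; split=> // y Dy; apply: x_min; exact: mem_set.
Qed.

Definition sqdist {R : realType} {S A : finType} (P Q : S -> A -> S -> R) : R :=
  \sum_s frobenius (fun a s' => P s a s' - Q s a s')
                   (fun a s' => P s a s' - Q s a s').

Section KernelSets.
Context {R : realType} {S A : finType}.
Implicit Types (P Q : S -> A -> S -> R) (PP : set (S -> A -> S -> R)).

Lemma entry_continuous (s : S) (a : A) (s' : S) :
  continuous (fun P : kernel_space R S A => P s a s' : R).
Proof.
move=> P.
have c1 := @proj_continuous S (fun _ => {ptws A -> {ptws S -> R}}) s P.
have c2 := @proj_continuous A (fun _ => {ptws S -> R}) a (P s).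
have c3 := @proj_continuous S (fun _ => R : topologicalType) s' (P s a).
exact: (continuous_comp (continuous_comp c1 c2) c3).
Qed.

Lemma sqdist_continuous Q :
  continuous (fun P : kernel_space R S A => sqdist P Q).
Proof.
apply: continuous_big => [|s _]; first exact: add_continuous.
by apply: frobenius_continuous => a s' P; apply: continuousB;
  [exact: entry_continuous|exact: cst_continuous
  |exact: entry_continuous|exact: cst_continuous].
Qed.

(** The segment from [P'] to [P] is written as a displacement from [P'], so that
    the squared distance along it is visibly a polynomial in [t]. *)
Lemma convex_set_segment PP :
  convex_set (PP : set (convex_lmodType (S -> A -> S -> R^o))) ->
  forall P P' t, PP P -> PP P' -> 0 <= t -> t <= 1 ->
    PP (fun s a s' => P' s a s' + t * (P s a s' - P' s a s')).
Proof.
move=> PP_convex P P' t PPP PPP' t_ge0 t_le1.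
have /set_mem :=
  PP_convex P P' (Itv01 t_ge0 t_le1) (mem_set PPP) (mem_set PPP').
congr PP; apply/funext => s; apply/funext => a; apply/funext => s'.
transitivity (t * P s a s' + (1 - t) * P' s a s'); first by [].
by ring.
Qed.

(** Moving from the closest point [P0] towards [P] along a segment of [PP] cannot
    bring the distance to [Q] down, so the derivative of the squared distance
    at [P0], which is twice [<P - P0, P0 - Q>], is nonnegative. *)
Lemma sqdist_min_variational PP Q P0 :
  convex_set (PP : set (convex_lmodType (S -> A -> S -> R^o))) ->
  argmin PP (sqdist^~ Q) P0 ->
  forall P, PP P ->
    \sum_s frobenius (P0 s) (fun a s' => P0 s a s' - Q s a s')
      <= \sum_s frobenius (P s) (fun a s' => P0 s a s' - Q s a s').
Proof.
move=> PP_convex [PPP0 P0_min] P PPP.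
pose V s a s' := P0 s a s' - Q s a s'.
pose D s a s' := P s a s' - P0 s a s'.
rewrite -subr_ge0 -sumrB.
under eq_bigr do rewrite -frobeniusBl.
apply: (@ge0_of_quadratic_ge0 _ _ (\sum_s frobenius (D s) (D s))).
  by apply: sumr_ge0 => s _; exact: frobenius_ge0.
move=> t t_ge0 t_le1.
have := P0_min _ (convex_set_segment _ PP_convex _ _ _ PPP PPP0 t_ge0 t_le1).
rewrite -subr_ge0 /sqdist -sumrB !mulr_sumr -big_split.
congr (0 <= _); apply: eq_bigr => s _ /=.
transitivity (frobenius (fun a s' => V s a s' + t * D s a s')
                        (fun a s' => V s a s' + t * D s a s')
              - frobenius (V s) (V s)).
  congr (frobenius _ _ - _); apply/funext => a; apply/funext => s';
    rewrite /V /D; ring.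
by rewrite frobenius_sqrDZ; ring.
Qed.

Lemma sqdist_le0 P Q : sqdist P Q <= 0 -> P = Q.
Proof.
move=> PQ_le0.
have PQ0 : sqdist P Q = 0.
  by apply: le_anti; rewrite PQ_le0 sumr_ge0 // => s _; exact: frobenius_ge0.
apply/funext => s; apply/funext => a; apply/funext => s'; apply/eqP.
rewrite -subr_eq0; apply/eqP.
have PQs0 := psumr_eq0P
  (fun i _ => frobenius_ge0 (fun a s' => P i a s' - Q i a s')) PQ0 (i := s) isT.
exact: frobenius_eq0 PQs0 a s'.
Qed.

Lemma marginal_self PP P s :
  PP `<=` @kernels R S A -> PP P -> marginal PP s (P s).
Proof. by move=> PP_kernel PPP; split; [exact: PP_kernel|exists P]. Qed.

End KernelSets.

Theorem theorem2 (R : realType) (S A : finType)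
    (S_gt0 : (0 < #|S|)%N) (A_gt0 : (0 < #|A|)%N)
    (PP : set (S -> A -> S -> R))
    (PP_kernel : PP `<=` @kernels R S A)
    (PP_neq0 : PP !=set0)
    (PP_convex : convex_set (PP : set (convex_lmodType (S -> A -> S -> R^o))))
    (PP_compact : compact (PP : set (kernel_space R S A))) :
  (forall V : S -> A -> S -> R,
     \bigcap_(s in [set: S]) argmin PP (fun P => frobenius (P s) (V s)) !=set0)
  <-> PP = [set P | forall s, marginal PP s (P s)].
Proof.
split=> [common_min|PP_rect V].
  apply/seteqP; split=> [P PPP s|Q Q_marg]; first exact: marginal_self.
  have [P0 P0_min] := @compact_argmin_neq0 R (kernel_space R S A) PP
    (sqdist^~ Q) PP_neq0 PP_compact (sqdist_continuous Q).
  pose V s a s' := P0 s a s' - Q s a s'.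
  have [P P_min] := common_min V.
  have PPP : PP P.
    (* [P_min] places [P] in [PP] only through some state. *)
    have /card_gt0P[s _] := S_gt0.
    by have [] := P_min s I.
  have P_le_Q : \sum_s frobenius (P s) (V s) <= \sum_s frobenius (Q s) (V s).
    apply: ler_sum => s _.
    have [_ Ps_min] := P_min s I.
    have [_ [P' PPP' <-]] := Q_marg s.
    exact: Ps_min.
  suff -> : Q = P0 by have [] := P0_min.
  apply/esym/sqdist_le0; rewrite /sqdist.
  under eq_bigr do rewrite frobeniusBl.
  rewrite sumrB subr_le0; apply: le_trans P_le_Q.
  exact: (sqdist_min_variational PP Q P0 PP_convex P0_min P PPP).
have /choice[m m_min] : forall s, exists P,
    argmin PP (fun P => frobenius (P s) (V s)) P.
  move=> s; apply: (@compact_argmin_neq0 R (kernel_space R S A)) => //.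
  apply: frobenius_continuous => a s'; first exact: entry_continuous.
  exact: cst_continuous.
exists (fun s => m s s) => s _; split=> [|P PPP];
  last by have [_] := m_min s; apply.
rewrite PP_rect => s1; have [PPm _] := m_min s1.
exact: marginal_self.
Qed.
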